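(* Let $T\in\mathrm{Hom}(V,\mathfrak g)$ be a strict homotopy relative Rota-Baxter operator on an $L_\infty$-algebra $(\mathfrak g,\{l_k\}_{k\ge1})$ with respect to a representation $(V,\{\rho_k\}_{k\ge1})$. Then $(V,\{\theta_k\}_{k\ge1})$ is a pre-Lie$_\infty$-algebra, where $\theta_k:\otimes^kV\to V$ ($k\ge1$) are the linear maps of degree $1$ defined by $$\theta_k(v_1,\dots,v_k):=\rho_k(Tv_1,\dots,Tv_{k-1},v_k),\qquad v_1,\dots,v_k\in V.$$
   Context: The base field has characteristic $0$; vector spaces are $\mathbb Z$-graded. $\mathsf S^k$ is the $k$-th graded symmetric power; $\varepsilon(\sigma)$ is the Koszul sign; $\mathbb S_{(i_1,\dots,i_k)}$ are the $(i_1,\dots,i_k)$-shuffles; in exponents, an element denotes its degree. $L_\infty$-algebra: a graded vector space $\mathfrak g$ with degree $1$ graded symmetric maps $l_k:\otimes^k\mathfrak g\to\mathfrak g$ ($k\ge1$) with $\sum_{i=1}^n\sum_{\sigma\in\mathbb S_{(i,n-i)}}\varepsilon(\sigma)l_{n-i+1}(l_i(x_{\sigma(1)},\dots,x_{\sigma(i)}),x_{\sigma(i+1)},\dots,x_{\sigma(n)})=0$ for all $n\ge1$. A representation on $V$: degree $1$ maps $\rho_k:\mathsf S^{k-1}(\mathfrak g)\otimes V\to V$ ($k\ge1$) such that for all $n\ge1$ and homogeneous $x_i\in\mathfrak g$, $v\in V$, $$\sum_{i=1}^{n-1}\sum_{\sigma\in\mathbb S_{(i,n-i-1)}}\varepsilon(\sigma)\rho_{n-i+1}(l_i(x_{\sigma(1)},\dots,x_{\sigma(i)}),x_{\sigma(i+1)},\dots,x_{\sigma(n-1)},v)+\sum_{i=1}^n\sum_{\sigma\in\mathbb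 S_{(n-i,i-1)}}\varepsilon(\sigma)(-1)^{x_{\sigma(1)}+\cdots+x_{\sigma(n-i)}}\rho_{n-i+1}(x_{\sigma(1)},\dots,x_{\sigma(n-i)},\rho_i(x_{\sigma(n-i+1)},\dots,x_{\sigma(n-1)},v))=0.$$ Strict homotopy relative Rota-Baxter operator: a degree $0$ map $T\in\mathrm{Hom}(V,\mathfrak g)$ with, for all $p\ge1$ and homogeneous $v_i\in V$, $l_p(Tv_1,\dots,Tv_p)=\sum_{i=1}^p(-1)^{(v_{i+1}+\cdots+v_p)v_i}T\rho_p(Tv_1,\dots,Tv_{i-1},Tv_{i+1},\dots,Tv_p,v_i)$. Pre-Lie$_\infty$-algebra: a graded vector space $V$ with degree $1$ maps $\theta_k:\mathsf S^{k-1}(V)\otimes V\to V$ ($k\ge1$) such that for all $n\ge1$ and homogeneous $v_1,\dots,v_n\in V$, $$\sum_{\substack{i+j=n+1\\i\ge1,j\ge2}}\sum_{\sigma\in\mathbb S_{(i-1,1,j-2)}}\varepsilon(\sigma)\theta_j(\theta_i(v_{\sigma(1)},\dots,v_{\sigma(i)}),v_{\sigma(i+1)},\dots,v_{\sigma(n-1)},v_n)+\sum_{\substack{i+j=n+1\\i,j\ge1}}\sum_{\sigma\in\mathbb S_{(j-1,i-1)}}(-1)^{v_{\sigma(1)}+\cdots+v_{\sigma(j-1)}}\varepsilon(\sigma)\theta_j(v_{\sigma(1)},\dots,v_{\sigma(j-1)},\theta_i(v_{\sigma(j)},\dots,v_{\sigma(n-1)},v_n))=0.$$ *)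

(* Defs.v *)
From HB Require Import structures.
From mathcomp Require Import all_boot all_order all_fingroup all_algebra.

Set Implicit Arguments.
Unset Strict Implicit.
Unset Printing Implicit Defensive.

Import GRing.Theory.
Local Open Scope ring_scope.

(* A Z-graded vector space is given by its total space together with the      *)
(* subspaces of homogeneous elements, of which it is the internal direct sum. *)
(* The zero vector is homogeneous of every degree.                            *)
Record gradedSpace (F : fieldType) := GradedSpace {
  gsort :> lmodType F;
  homog : int -> gsort -> Prop;
  homog0 : forall e, homog e 0;
  homog_linear : forall e (a : F) (x y : gsort),
    homog e x -> homog e y -> homog e (a *: x + y);
  homog_span : forall x : gsort, exists (r : seq int) (c : int -> gsort),
    [/\ uniq r, forall e, homog e (c e) & x = \sum_(e <- r) c e];
  homog_free : forall (r : seq int) (c : int -> gsort),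
    uniq r -> (forall e, homog e (c e)) -> \sum_(e <- r) c e = 0 ->
    forall e, e \in r -> c e = 0
}.

(* The word x_{s(1)}, ..., x_{s(n)}.                                          *)
Definition permuted (A : Type) n (x : 'I_n -> A) (s : 'S_n) : seq A :=
  [seq x (s a) | a <- enum 'I_n].

(* s is increasing on each of the consecutive blocks of sizes c_1, ..., c_k;  *)
(* empty blocks are allowed.                                                  *)
Definition shuffle n (c : seq nat) (s : 'S_n) : bool :=
  (sumn c == n) && all (sorted ltn) (reshape c (permuted val s)).

(* The sign with x_1 ... x_n = koszul F d s * x_{s(1)} ... x_{s(n)} in the    *)
(* graded symmetric algebra, for x_i of degree d_i.                           *)
Definition koszul (F : fieldType) n (d : 'I_n -> int) (s : 'S_n) : F :=
  \prod_(a < n) \prod_(b < n | (a < b)%N && (s b < s a)%N)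
    (-1) ^ (d (s a) * d (s b)).

Section Structures.
Variable F : fieldType.
Implicit Types g V W : gradedSpace F.

(* A family (l_k)_{k >= 1} of k-ary maps is encoded by one function l on      *)
(* finite sequences, l_k being its restriction to sequences of length k. The  *)
(* value of l at the empty sequence is never used.                            *)
Record symmetric_degree1 g (l : seq g -> g) : Prop := {
  sd1_linear : forall u w : seq g, linear (fun x : g => l (u ++ x :: w));
  sd1_degree : forall n (x : 'I_n -> g) (d : 'I_n -> int), (0 < n)%N ->
    (forall a, homog (d a) (x a)) ->
    homog (\sum_a d a + 1) (l [seq x a | a <- enum 'I_n]);
  sd1_sym : forall n (x : 'I_n -> g) (d : 'I_n -> int) (s : 'S_n), (0 < n)%N ->
    (forall a, homog (d a) (x a)) ->
    l [seq x a | a <- enum 'I_n] = koszul F d s *: l (permuted x s)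
}.

Record Linfty_algebra g (l : seq g -> g) : Prop := {
  Linfty_maps : symmetric_degree1 l;
  Linfty_rel : forall n (x : 'I_n -> g) (d : 'I_n -> int), (0 < n)%N ->
    (forall a, homog (d a) (x a)) ->
    \sum_(1 <= i < n.+1) \sum_(s : 'S_n | shuffle [:: i; n - i]%N s)
      koszul F d s *: l (l (take i (permuted x s)) :: drop i (permuted x s))
    = 0
}.

(* A family of maps f_k : S^{k-1}(g) (x) V -> V, k >= 1, is encoded by        *)
(* f : seq g -> V -> V, with f_k(x_1, ..., x_{k-1}, v) =                      *)
(* f [:: x_1; ...; x_{k-1}] v; so f_1 is f [::].                              *)
Record action_degree1 g V (f : seq g -> V -> V) : Prop := {
  ad1_linear : forall (u w : seq g) (v : V),
    linear (fun x : g => f (u ++ x :: w) v);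
  ad1_linear_last : forall u : seq g, linear (f u);
  ad1_degree : forall n (x : 'I_n -> g) (d : 'I_n -> int) (v : V) (e : int),
    (forall a, homog (d a) (x a)) -> homog e v ->
    homog (\sum_a d a + e + 1) (f [seq x a | a <- enum 'I_n] v);
  ad1_sym : forall n (x : 'I_n -> g) (d : 'I_n -> int) (s : 'S_n) (v : V),
    (forall a, homog (d a) (x a)) ->
    f [seq x a | a <- enum 'I_n] v = koszul F d s *: f (permuted x s) v
}.

Record Linfty_representation g (l : seq g -> g) V (rho : seq g -> V -> V)
    : Prop := {
  rep_maps : action_degree1 rho;
  rep_rel : forall n (x : 'I_n.-1 -> g) (d : 'I_n.-1 -> int) (v : V) (e : int),
    (0 < n)%N -> (forall a, homog (d a) (x a)) -> homog e v ->
    \sum_(1 <= i < n) \sum_(s : 'S_n.-1 | shuffle [:: i; n - i - 1]%N s)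
      koszul F d s *:
        rho (l (take i (permuted x s)) :: drop i (permuted x s)) v
    + \sum_(1 <= i < n.+1) \sum_(s : 'S_n.-1 | shuffle [:: n - i; i - 1]%N s)
      (koszul F d s * (-1) ^ (\sum_(a < n.-1 | (a < n - i)%N) d (s a))) *:
        rho (take (n - i) (permuted x s))
            (rho (drop (n - i) (permuted x s)) v)
    = 0
}.

Record strict_homotopy_relative_RB g (l : seq g -> g) V (rho : seq g -> V -> V)
    (T : {linear V -> g}) : Prop := {
  RB_degree : forall (e : int) (v : V), homog e v -> homog e (T v);
  RB_rel : forall p (v : 'I_p -> V) (d : 'I_p -> int), (0 < p)%N ->
    (forall a, homog (d a) (v a)) ->
    l [seq T (v a) | a <- enum 'I_p] =
    \sum_(i < p) (-1) ^ ((\sum_(b < p | (i < b)%N) d b) * d i) *: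
      T (rho [seq T (v a) | a <- enum 'I_p & a != i] (v i))
}.

(* In both sums of the relation j = n + 1 - i. In the first one, the i-th     *)
(* letter of the permuted word is the last argument of theta_i.               *)
Record preLie_infty_algebra V (theta : seq V -> V -> V) : Prop := {
  preLie_maps : action_degree1 theta;
  preLie_rel : forall n (x : 'I_n.-1 -> V) (d : 'I_n.-1 -> int) (v : V)
      (e : int),
    (0 < n)%N -> (forall a, homog (d a) (x a)) -> homog e v ->
    \sum_(1 <= i < n) (let j := (n.+1 - i)%N in
      \sum_(s : 'S_n.-1 | shuffle [:: i - 1; 1; j - 2]%N s)
        koszul F d s *:
          theta (theta (take (i - 1) (permuted x s))
                       (nth 0 (permuted x s) (i - 1))
                 :: drop i (permuted x s)) v)
    + \sum_(1 <= i < n.+1) (let j := (n.+1 - i)%N in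
      \sum_(s : 'S_n.-1 | shuffle [:: j - 1; i - 1]%N s)
        ((-1) ^ (\sum_(a < n.-1 | (a < j - 1)%N) d (s a)) * koszul F d s) *:
          theta (take (j - 1) (permuted x s))
                (theta (drop (j - 1) (permuted x s)) v))
    = 0
}.

End Structures.

(* Main.v *)
Require Import Defs.
From HB Require Import structures.
From mathcomp Require Import all_boot all_order all_fingroup all_algebra.
From mathcomp Require Import zify.

Set Implicit Arguments.
Unset Strict Implicit.
Unset Printing Implicit Defensive.

Import GRing.Theory.
Local Open Scope ring_scope.

(** A strict homotopy relative Rota-Baxter operator turns the representation
    identity into the pre-Lie identity term by term.  Evaluate the identity of
    the representation on the letters T x_1, ..., T x_m and v.  Its second sum,
    in which rho is nested inside rho, is literally the second sum of the
    pre-Lie identity.  In its first sum each summand contains a bracket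
    l_i (T x_{s(1)}, ..., T x_{s(i)}) for an (i, m - i)-shuffle s, and the
    Rota-Baxter identity replaces it by a sum over k of
    T rho_i (T x_{s(1)}, ..., omit k, ..., T x_{s(i)}, x_{s(k)}): the k-th
    letter is moved to the end of the block.

    So the pair (s, k) produces the word x permuted by cyc k * s, where cyc k is
    the cycle of positions moving k to the end of the first block, and two facts
    remain.
    - The signs agree: the Koszul sign is a cocycle (koszulM), and on cyc k it
      is the sign of the Rota-Baxter identity (koszul_cyc).
    - The pairs (s, k) are in bijection with the (i - 1, 1, m - i)-shuffles of
      the pre-Lie identity by (s, k) |-> cyc k * s (sum_shuffle_cyc).  A shuffle
      t of the latter kind comes from exactly one k, the number of letters of
      its first block below its distinguished letter t_i
      (last_letter_position).

    RB_substitution combines the two.  Symmetry, multilinearity and degree of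
    the new operations pass through T since T is linear of degree 0. *)

(** * The Koszul sign *)

Section KoszulSign.
Variable F : fieldType.

Lemma sqr_sign (z : int) : ((-1) ^ z : F) * (-1) ^ z = 1.
Proof. by rewrite -expfzMl mulrNN mulr1 exp1rz. Qed.

Lemma sign_sum (I : Type) (r : seq I) (P : pred I) (f : I -> int) :
  (-1) ^ (\sum_(i <- r | P i) f i) = \prod_(i <- r | P i) (-1) ^ f i :> F.
Proof.
by apply: big_morph => // z1 z2; rewrite expfzDr // oppr_eq0 oner_eq0.
Qed.

(** A symmetric G defines a function on unordered pairs of indices, and u
    permutes these; the proof compares the ordered representatives, swapping
    the two entries of the pairs that u inverts. *)
Lemma prod_pairs_perm n (G : 'I_n -> 'I_n -> F) (u : 'S_n) :
  (forall a b, G a b = G b a) ->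
  \prod_(a < n) \prod_(b < n | (a < b)%N) G (u a) (u b) =
  \prod_(a < n) \prod_(b < n | (a < b)%N) G a b.
Proof.
move=> Gsym; rewrite !pair_big_dep /=.
pose h (w : 'S_n) (p : 'I_n * 'I_n) := (w p.1, w p.2).
have hK : cancel (h u^-1%g) (h u) by case=> a b; rewrite /h /= !permKV.
have hK' : cancel (h u) (h u^-1%g) by case=> a b; rewrite /h /= !permK.
rewrite (reindex (h u^-1%g)) /=; last first.
  by exists (h u) => p _; [exact: hK | exact: hK'].
under eq_bigr => p _ do rewrite !permKV.
rewrite [LHS](bigID (fun p : 'I_n * 'I_n => (p.1 < p.2)%N)) /=.
rewrite [RHS](bigID (fun p : 'I_n * 'I_n => (u^-1%g p.1 < u^-1%g p.2)%N)) /=.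
congr (_ * _); first by apply: eq_bigl => p; rewrite andbC.
pose sw (p : 'I_n * 'I_n) := (p.2, p.1).
rewrite (reindex sw) /=; last by exists sw => -[a b].
apply: eq_big => [[a b]|[a b] _] /=; last exact: Gsym.
have [->|ne] := eqVneq a b; first by rewrite !ltnn.
have ne1 : val a != val b by [].
have ne2 : val (u^-1%g a) != val (u^-1%g b) by rewrite (inj_eq val_inj) (inj_eq perm_inj).
move: ne1 ne2 => /=; lia.
Qed.

(** The cocycle identity.  A pair is inverted by u * s exactly when it is
    inverted by one, but not both, of u and (after moving it by u) s; a pair
    inverted by both contributes the same sign twice, hence 1.  To compare the
    products, the sign of s is first written as a product over unordered pairs,
    which may then be reindexed by u. *)
Lemma koszulM n (d : 'I_n -> int) (u s : 'S_n) :
  koszul F d (u * s)%g = koszul F d s * koszul F (fun a => d (s a)) u.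
Proof.
pose e a b : F := (-1) ^ (d (s a) * d (s b)).
pose G (a b : 'I_n) : F := if (a < b)%N (+) (s a < s b)%N then e a b else 1.
have Gsym a b : G a b = G b a.
  rewrite /G /e mulrC; have [->//|ne] := eqVneq a b.
  have ne1 : val a != val b by [].
  have ne2 : val (s a) != val (s b) by rewrite (inj_eq val_inj) (inj_eq perm_inj).
  congr (if _ then _ else _); move: ne1 ne2 => /=; lia.
have -> : koszul F d s = \prod_(a < n) \prod_(b < n | (a < b)%N) G a b.
  apply: eq_bigr => a _; rewrite big_mkcondr /=; apply: eq_bigr => b ab.
  have ne2 : val (s a) != val (s b).
    by rewrite (inj_eq val_inj) (inj_eq perm_inj); apply: contraTneq ab => ->; rewrite ltnn.
  rewrite /G ab; congr (if _ then _ else _); move: ne2 => /=; lia.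
rewrite -(prod_pairs_perm u Gsym) -big_split /=.
apply: eq_bigr => a _; rewrite !big_mkcondr /= -big_split /=.
apply: eq_bigr => b ab; rewrite !permM /G -/(e (u a) (u b)).
have ne : a != b by apply: contraTneq ab => ->; rewrite ltnn.
have ne1 : val (u a) != val (u b) by rewrite (inj_eq val_inj) (inj_eq perm_inj).
have ne2 : val (s (u a)) != val (s (u b)).
  by rewrite !(inj_eq val_inj) !(inj_eq perm_inj).
have e2 : e (u a) (u b) * e (u a) (u b) = 1 by apply: sqr_sign.
by move: ne1 ne2 => /=; case: (ltngtP (u a) (u b)) => //= _ _;
  case: (ltngtP (s (u a)) (s (u b))) => //= _ _; rewrite ?e2 ?mulr1 ?mul1r.
Qed.

End KoszulSign.

(** * The cycle moving a letter to the end of its block *)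

(** The cycle k -> k+1 -> ... -> j -> k on positions, where k <= j: the letter
    read at position j of the new word is the k-th letter of the old one, and
    the letters in between move one place to the left. *)
Definition cyc_fun (k j a : nat) : nat :=
  if (k <= a < j)%N then a.+1 else if a == j then k else a.

Definition cyc_inv (k j a : nat) : nat :=
  if (k < a <= j)%N then a.-1 else if a == k then j else a.

Lemma cyc_funK k j : (k <= j)%N -> cancel (cyc_fun k j) (cyc_inv k j).
Proof. by move=> kj a; rewrite /cyc_fun /cyc_inv; repeat case: ifP; lia. Qed.

Section Cycle.
Variables (m : nat) (j : 'I_m).

Lemma cyc_fun_lt (k : 'I_j.+1) (a : 'I_m) : (cyc_fun k j a < m)%N.
Proof.
by rewrite /cyc_fun; have := ltn_ord a; have := ltn_ord j; have := ltn_ord k;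
  repeat case: ifP; lia.
Qed.

Lemma cyc_ord_inj (k : 'I_j.+1) : injective (fun a => Ordinal (cyc_fun_lt k a)).
Proof.
by move=> a b [] /(can_inj (cyc_funK (ltn_ord k : k <= j)%N)) /val_inj.
Qed.

Definition cyc (k : 'I_j.+1) : 'S_m := perm (@cyc_ord_inj k).

Lemma cycE k a : cyc k a = cyc_fun k j a :> nat.
Proof. by rewrite permE. Qed.

Lemma cycVE k a : (cyc k)^-1%g a = cyc_inv k j a :> nat.
Proof.
by rewrite -{2}(permKV (cyc k) a) cycE cyc_funK // -ltnS.
Qed.

(** The only inversions of cyc k have j as second position: the k-th letter is
    carried past the letters k+1, ..., j.  The copy k' of k in 'I_m is there to
    apply d to it. *)
Lemma koszul_cyc (F : fieldType) (d : 'I_m -> int) (k : 'I_j.+1) (k' : 'I_m) :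
  k' = k :> nat ->
  koszul F d (cyc k) = (-1) ^ ((\sum_(b < m | (k < b <= j)%N) d b) * d k').
Proof.
move=> k'k; rewrite mulr_suml sign_sum /koszul.
have cj : cyc k j = k'.
  by apply: val_inj; rewrite /= cycE k'k /cyc_fun eqxx ltnn andbF.
rewrite [RHS](reindex_inj (@perm_inj _ (cyc k))) [RHS]big_mkcond /=.
apply: eq_bigr => a _.
have klej : (k <= j)%N by rewrite -ltnS.
have H (b : 'I_m) : ((a < b) && (cyc k b < cyc k a))%N = (k < cyc k a <= j)%N && (b == j).
  rewrite !cycE -(inj_eq val_inj) /cyc_fun /=; repeat case: ifP; lia.
case: ifP => Ha; last by apply: big1 => b; rewrite H Ha.
by rewrite (eq_bigl (pred1 j)) => [|b]; rewrite ?big_pred1_eq ?cj // H Ha.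
Qed.

End Cycle.

(** * Shuffles *)

Lemma size_permuted (A : Type) m (x : 'I_m -> A) (s : 'S_m) :
  size (permuted x s) = m.
Proof. by rewrite size_map size_enum_ord. Qed.

Lemma nth_permuted (A : Type) (x0 : A) m (x : 'I_m -> A) (s : 'S_m) (a : 'I_m) :
  nth x0 (permuted x s) a = x (s a).
Proof. by rewrite (nth_map a) ?size_enum_ord // nth_ord_enum. Qed.

Lemma sorted_slice m (s : 'S_m) lo sz : (lo + sz <= m)%N ->
  reflect (forall a b : 'I_m,
      (lo <= a)%N -> (a < b)%N -> (b < lo + sz)%N -> (s a < s b)%N)
    (sorted ltn (take sz (drop lo (permuted val s)))).
Proof.
move=> le; rewrite sorted_pairwise; last exact: ltn_trans.
have szt : size (take sz (drop lo (permuted val s))) = sz.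
  by rewrite size_takel // size_drop size_permuted; lia.
have nthw (a : 'I_m) : nth 0%N (permuted val s) a = s a := nth_permuted _ _ _ a.
apply: (iffP (pairwiseP 0%N)); rewrite szt => H.
  move=> a b la ab lb.
  have := H (a - lo)%N (b - lo)%N; rewrite !inE !nth_take ?nth_drop; try lia.
  by rewrite !subnKC ?nthw; try lia; apply; lia.
move=> a b; rewrite !inE => la lb ab.
have am : (lo + a < m)%N by lia.
have bm : (lo + b < m)%N by lia.
rewrite !nth_take // !nth_drop (nthw (Ordinal am)) (nthw (Ordinal bm)).
by apply: H => /=; lia.
Qed.

Lemma shuffle2P m (s : 'S_m) i : (i <= m)%N ->
  reflect (forall a b : 'I_m,
      (a < b)%N -> (b < i)%N || (i <= a)%N -> (s a < s b)%N)
    (shuffle [:: i; m - i]%N s).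
Proof.
move=> im; rewrite /shuffle /= addn0 subnKC // eqxx andbT /=.
rewrite -[X in take i X]drop0.
apply: (iffP andP) => [[] /sorted_slice A /sorted_slice B a b ab /orP[bi|ia]|H].
- by apply: A; lia.
- by apply: B => //; have := ltn_ord b; lia.
by split; apply/sorted_slice => [|a b *]; try lia; apply: H => //; lia.
Qed.

(** The middle block has one letter, at position j, and imposes nothing. *)
Lemma shuffle3P m (s : 'S_m) j : (j < m)%N ->
  reflect (forall a b : 'I_m,
      (a < b)%N -> (b < j)%N || (j < a)%N -> (s a < s b)%N)
    (shuffle [:: j; 1; m - j.+1]%N s).
Proof.
move=> jm; rewrite /shuffle /= addn0 -[_ + _ == _]/(_ + (1 + _) == _)%N.
have -> : (j + (1 + (m - j.+1)) == m)%N by lia.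
rewrite -[X in take j X]drop0 andbT drop_drop add1n /=.
have -> : sorted ltn (take 1 (drop j (permuted val s))).
  by case: drop => //= x y; rewrite take0.
apply: (iffP andP) => [[] /sorted_slice A /sorted_slice B a b ab /orP[bi|ia]|H].
- by apply: A; lia.
- by apply: B => //; have := ltn_ord b; lia.
by split; apply/sorted_slice => [|a b *]; try lia; apply: H => //; lia.
Qed.

(** The word of cyc k ^-1 * t is the word of t with its letter t j inserted at
    position k of the first block.  This block is then increasing if and only
    if the block of t without t j was increasing, and t j is larger than the
    letters on its left and smaller than those on its right. *)
Lemma shuffle_cycV m (j : 'I_m) (t : 'S_m) (k : 'I_j.+1) :
  shuffle [:: j.+1; m - j.+1]%N ((cyc k)^-1 * t)%g =
  shuffle [:: val j; 1; m - j.+1]%N t &&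
    [forall a : 'I_m, (a < j)%N ==> ((a < k)%N == (t a < t j)%N)].
Proof.
have klej : (k <= j)%N by rewrite -ltnS.
set c := cyc k.
have cV a : c^-1%g a = cyc_inv k j a :> nat by apply: cycVE.
have cE a : c a = cyc_fun k j a :> nat by apply: cycE.
have cj : c^-1%g (c j) = j by rewrite permK.
apply/(shuffle2P _ (ltn_ord j))/andP => [H|[/(shuffle3P _ (ltn_ord j)) A /forallP B]].
  have H' a b : (c a < c b)%N -> (c b < j.+1)%N || (j < c a)%N -> (t a < t b)%N.
    by move=> ab q; have := H _ _ ab q; rewrite !permM !permK.
  split.
    apply/(shuffle3P _ (ltn_ord j)) => a b ab q; apply: H'; rewrite !cE /cyc_fun;
      repeat case: ifP; lia.
  apply/forallP => a; apply/implyP => aj; apply/eqP.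
  have [ak|ka] := ltnP a k.
    by apply/esym/H'; rewrite !cE /cyc_fun; repeat case: ifP; lia.
  suff : (t j < t a)%N by lia.
  by apply: H'; rewrite !cE /cyc_fun; repeat case: ifP; lia.
move=> a b ab q; rewrite !permM.
have Ca := cV a; have Cb := cV b.
have [Ea|Na] := eqVneq (val a) (val k).
  have -> : c^-1%g a = j.
    by apply: val_inj; rewrite /= Ca /cyc_inv; move: Ea => /=;
      repeat case: ifP; lia.
  have bj : (b < j.+1)%N by case/orP: q => //; move: Ea klej => /=; lia.
  have b'j : (c^-1%g b < j)%N.
    by rewrite Cb /cyc_inv; move: Ea => /=; repeat case: ifP; lia.
  have := B (c^-1%g b); rewrite b'j /= => /eqP.
  have -> : (c^-1%g b < k)%N = false.
    by rewrite Cb /cyc_inv; move: Ea => /=; repeat case: ifP; lia.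
  have : t (c^-1%g b) != t j :> nat.
    by rewrite !(inj_eq val_inj) (inj_eq perm_inj) -(inj_eq val_inj) /=; lia.
  by lia.
have [Eb|Nb] := eqVneq (val b) (val k).
  have -> : c^-1%g b = j.
    by apply: val_inj; rewrite /= Cb /cyc_inv; move: Eb => /=;
      repeat case: ifP; lia.
  have a'j : (c^-1%g a < j)%N.
    by rewrite Ca /cyc_inv; move: Eb => /=; repeat case: ifP; lia.
  have := B (c^-1%g a); rewrite a'j /= => /eqP <-.
  by rewrite Ca /cyc_inv; move: Eb => /=; repeat case: ifP; lia.
by move: Na Nb => /= Na Nb; apply: A; rewrite Ca Cb /cyc_inv; repeat case: ifP; lia.
Qed.

(** The insertion point of t j in the increasing sequence t 0 < ... < t (j-1)
    exists and is unique.  It is found as the first position carrying a letter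
    larger than t j, or j if there is none. *)
Lemma last_letter_position m (j : 'I_m) (t : 'S_m) :
  shuffle [:: val j; 1; m - j.+1]%N t ->
  exists k0 : 'I_j.+1, forall k : 'I_j.+1,
    [forall a : 'I_m, (a < j)%N ==> ((a < k)%N == (t a < t j)%N)] = (k == k0).
Proof.
move=> /(shuffle3P _ (ltn_ord j)) A.
pose P k := (k == j :> nat) || [exists a : 'I_m, (a == k :> nat) && (t j < t a)%N].
have exP : exists k, P k by exists j; rewrite /P eqxx.
case: (ex_minnP exP) => k0 Pk0 mink0.
have k0j : (k0 < j.+1)%N by rewrite ltnS mink0 // /P eqxx.
have Hk0 (a : 'I_m) : (a < j)%N -> (a < k0)%N = (t a < t j)%N.
  move=> aj; have ne : t a != t j :> nat.
    by rewrite !(inj_eq val_inj) (inj_eq perm_inj) -(inj_eq val_inj) /=; lia.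
  have [ak|ka] := ltnP a k0.
    have [//|ta] := ltnP (t a) (t j).
    have /mink0 : P a by apply/orP; right; apply/existsP; exists a; rewrite eqxx /=; lia.
    by lia.
  case/orP: Pk0 => [/eqP|/existsP[b /andP[/eqP bk tb]]]; first lia.
  have [eab|nab] := eqVneq a b; first by subst b; lia.
  have nab' : val a != val b by [].
  suff : (t b < t a)%N by lia.
  by apply: A; move: nab' => /=; lia.
exists (Ordinal k0j) => k; apply/forallP/eqP => [H|->a].
  have agree (a : 'I_m) : (a < j)%N -> (a < k)%N = (a < k0)%N.
    by move=> aj; have := H a; rewrite aj (Hk0 a aj) => /eqP.
  (* If k and k0 differed, the smaller of the two would contradict agree. *)
  have jm := ltn_ord j; have kj := ltn_ord k.
  apply: val_inj => /=; case: (ltngtP k k0) => // lt.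
    have km : (k < m)%N by lia.
    by have := agree (Ordinal km); rewrite /= lt ltnn; lia.
  have k0m : (k0 < m)%N by lia.
  by have := agree (Ordinal k0m); rewrite /= lt ltnn; lia.
by apply/implyP => aj; rewrite /= Hk0.
Qed.

(** The bijection (s, k) |-> cyc k * s between the two kinds of shuffles, as an
    equality of sums: for fixed k reindex by t = cyc k * s, then exchange the
    sums; every t is met for the single k of last_letter_position. *)
Lemma sum_shuffle_cyc (W : nmodType) m (j : 'I_m) (G : 'S_m -> W) :
  \sum_(s | shuffle [:: j.+1; m - j.+1]%N s) \sum_(k < j.+1) G (cyc k * s)%g =
  \sum_(t | shuffle [:: val j; 1; m - j.+1]%N t) G t.
Proof.
rewrite exchange_big /=.
transitivity (\sum_(k < j.+1)
    \sum_(t | shuffle [:: j.+1; m - j.+1]%N ((cyc k)^-1 * t)%g) G t).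
  apply: eq_bigr => k _; rewrite (reindex_inj (mulgI (cyc k)^-1%g)) /=.
  by apply: eq_bigr => t _; rewrite mulKVg.
under [LHS]eq_bigr => k _ do
  rewrite (eq_bigl _ _ (fun t => shuffle_cycV t k)) big_mkcondr.
rewrite exchange_big /=; apply: eq_bigr => t /last_letter_position[k0 H].
by under eq_bigr => k _ do rewrite H; rewrite -big_mkcond big_pred1_eq.
Qed.

(** * Permuted words *)

Section Words.
Variables (A : Type) (m : nat) (x0 : A).
Implicit Types (x : 'I_m -> A) (s : 'S_m).

Lemma map_permuted (B : Type) (f : A -> B) x s :
  permuted (fun a => f (x a)) s = map f (permuted x s).
Proof. by rewrite /permuted -map_comp. Qed.

Lemma take_permuted x s p (le : (p <= m)%N) :
  take p (permuted x s) = [seq x (s (widen_ord le a)) | a <- enum 'I_p].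
Proof.
apply: (@eq_from_nth _ x0) => [|a]; rewrite size_takel ?size_permuted //.
  by rewrite size_map size_enum_ord.
move=> ap; rewrite nth_take // (nth_map (Ordinal ap)) ?size_enum_ord //.
rewrite -[a]/(nat_of_ord (widen_ord le (Ordinal ap))) nth_permuted.
by rewrite (nth_ord_enum _ (Ordinal ap)).
Qed.

Lemma map_enum_neq (y : 'I_m -> A) (k : 'I_m) :
  [seq y a | a <- enum 'I_m & a != k] =
  take k [seq y a | a <- enum 'I_m] ++ drop k.+1 [seq y a | a <- enum 'I_m].
Proof.
by rewrite -rem_filter ?enum_uniq // remE index_enum_ord map_cat map_take map_drop.
Qed.

Variables (j : 'I_m) (k : 'I_j.+1).

Lemma take_permuted_cyc x s :
  take j (permuted x (cyc k * s)%g) =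
  take k (take j.+1 (permuted x s)) ++ drop k.+1 (take j.+1 (permuted x s)).
Proof.
have kj : (k <= j)%N by rewrite -ltnS.
have jm := ltn_ord j.
have szY : size (take j.+1 (permuted x s)) = j.+1 by rewrite size_takel ?size_permuted.
have szk : size (take k (take j.+1 (permuted x s))) = k by rewrite size_takel ?szY; lia.
apply: (@eq_from_nth _ x0) => [|a].
  by rewrite size_cat szk size_drop szY size_takel ?size_permuted; lia.
rewrite size_takel ?size_permuted; last lia.
move=> aj.
have am : (a < m)%N by lia.
rewrite nth_take // (nth_permuted _ _ _ (Ordinal am)) permM nth_cat szk.
have [ak|ka] := ltnP a k.
  rewrite nth_take // nth_take; last lia.
  rewrite (nth_permuted _ _ _ (Ordinal am)); congr (x (s _)).
  by apply: val_inj; rewrite /= cycE /cyc_fun /=; repeat case: ifP; lia.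
rewrite nth_drop nth_take; last lia.
have -> : (k.+1 + (a - k) = cyc k (Ordinal am))%N.
  by rewrite cycE /cyc_fun /=; repeat case: ifP; lia.
by rewrite nth_permuted.
Qed.

Lemma nth_permuted_cyc x s (k' : 'I_m) :
  k' = k :> nat -> nth x0 (permuted x (cyc k * s)%g) j = x (s k').
Proof.
move=> k'k; rewrite nth_permuted permM; congr (x (s _)).
by apply: val_inj; rewrite /= cycE k'k /cyc_fun eqxx ltnn andbF.
Qed.

Lemma drop_permuted_cyc x s :
  drop j.+1 (permuted x (cyc k * s)%g) = drop j.+1 (permuted x s).
Proof.
apply: (@eq_from_nth _ x0) => [|a]; rewrite !size_drop !size_permuted //.
move=> am; rewrite !nth_drop.
have am' : (j.+1 + a < m)%N by lia.
rewrite !(nth_permuted _ _ _ (Ordinal am')) permM; congr (x (s _)).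
have := ltn_ord k.
by move=> kj; apply: val_inj; rewrite /= cycE /cyc_fun /=; repeat case: ifP; lia.
Qed.

End Words.

Lemma linear_comb (R : nzRingType) (U W : lmodType R) (f : U -> W) (I : Type) (r : seq I)
    (a : I -> R) (u : I -> U) :
  linear f -> f (\sum_(i <- r) a i *: u i) = \sum_(i <- r) a i *: f (u i).
Proof.
move=> lf; pose fl : {linear U -> W} := HB.pack f (GRing.isLinear.Build _ _ _ _ f lf).
rewrite -[LHS]/(fl _) linear_sum; apply: eq_bigr => i _.
exact: (linearZ_LR fl).
Qed.

(** * Transport of structure along the Rota-Baxter operator *)

Section Descent.
Variables (F : fieldType) (g V : gradedSpace F).
Variables (l : seq g -> g) (rho : seq g -> V -> V) (T : {linear V -> g}).
Hypotheses (hrho : action_degree1 rho) (hT : strict_homotopy_relative_RB l rho T).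

Let theta (vs : seq V) (v : V) := rho [seq T u | u <- vs] v.

Lemma theta_action : action_degree1 theta.
Proof.
split=> [u w v a y z|u|n x d v e hx hv|n x d s v hx].
- by rewrite /theta !map_cat /= linearP (ad1_linear hrho).
- exact: (ad1_linear_last hrho).
- rewrite /theta -map_comp; apply: (ad1_degree hrho) => // a.
  exact: (RB_degree hT).
- rewrite /theta -map_comp -map_permuted (ad1_sym hrho (d := d) s) // => a.
  exact: (RB_degree hT).
Qed.

(** Expanding the bracket by the Rota-Baxter identity, with i = j + 1, gives the
    summand of cyc k * s for each k in the block.  Its Koszul sign is the
    product of the sign of s and that of cyc k for the permuted degrees
    d (s a); the latter is the sign in the Rota-Baxter identity. *)
Lemma RB_substitution m (j : 'I_m) (x : 'I_m -> V) (d : 'I_m -> int) (v : V) :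
  (forall a, homog (d a) (x a)) ->
  \sum_(s | shuffle [:: j.+1; m - j.+1]%N s)
    koszul F d s *: rho (l (take j.+1 (permuted (fun a => T (x a)) s))
                         :: drop j.+1 (permuted (fun a => T (x a)) s)) v =
  \sum_(s | shuffle [:: val j; 1; m - j.+1]%N s)
    koszul F d s *: theta (theta (take j (permuted x s)) (nth 0 (permuted x s) j)
                            :: drop j.+1 (permuted x s)) v.
Proof.
move=> hx; rewrite -sum_shuffle_cyc; apply: eq_bigr => s _.
have le : (j.+1 <= m)%N := ltn_ord j.
rewrite (take_permuted 0 _ _ le).
rewrite (RB_rel hT (d := fun a => d (s (widen_ord le a)))) //.
rewrite (linear_comb _ _ _ (ad1_linear hrho [::] _ v)) /= scaler_sumr.
apply: eq_bigr => k _; rewrite scalerA koszulM.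
rewrite (@koszul_cyc _ _ _ _ k (widen_ord le k)) //.
congr ((_ * (-1) ^ (_ * _)) *: _).
  by rewrite (big_ord_narrow_cond (P := fun b : 'I_m => (k < b)%N)
    (F := fun b => d (s b)) le).
rewrite /theta /= (take_permuted_cyc 0)
  (nth_permuted_cyc 0 x s (erefl : widen_ord le k = k :> nat)).
rewrite (drop_permuted_cyc 0) map_permuted !map_drop map_enum_neq.
congr (rho (T (rho _ _) :: _) v).
by rewrite (take_permuted 0 _ _ le) map_cat map_take map_drop -[in RHS]map_comp.
Qed.

End Descent.

Theorem theorem5p18 (F : fieldType) (charF : [pchar F] =i pred0)
    (g V : gradedSpace F) (l : seq g -> g) (rho : seq g -> V -> V)
    (T : {linear V -> g})
    (hl : Linfty_algebra l) (hrho : Linfty_representation l rho)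
    (hT : strict_homotopy_relative_RB l rho T) :
  preLie_infty_algebra (fun (vs : seq V) (v : V) => rho [seq T u | u <- vs] v).
Proof.
split; first exact: (theta_action (rep_maps hrho) hT).
case=> [//|m] /= x d v e _ hx hv.
have hTx a : homog (d a) (T (x a)) by apply: (RB_degree hT).
apply: etrans (rep_rel hrho (n := m.+1) (ltn0Sn m) hTx hv) => /=.
congr (_ + _).
  rewrite !big_add1 /= !big_mkord; apply: eq_bigr => j _.
  have -> : (m.+1 - j.+1 - 1 = m - j.+1)%N by lia.
  have -> : (m.+2 - j.+1 - 2 = m - j.+1)%N by lia.
  rewrite subn1 /=; symmetry; exact: (RB_substitution (rep_maps hrho) hT).
apply: eq_big_nat => i /andP[i_gt0 i_le].
have -> : (m.+2 - i - 1 = m.+1 - i)%N by lia.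
apply: eq_bigr => s _; rewrite mulrC (map_permuted T x s).
by rewrite map_take map_drop.
Qed.
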